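(* Let $k\ge 2$ be an integer. For every sequence $(\psi_n)_{n\ge 0}$ of substitutions with $\psi_n\in S$ for all $n\ge 0$, the $S$-adic sequence $\lim_{n\to\infty}\psi_0\psi_1\cdots\psi_{n-1}(0)$ is the faithful coding of the $B$-integers for some Cantor real base $B$. Here $S=\{\eta_{\mathbf{c}} : \mathbf{c}=(c_1,\ldots,c_k)\in\mathbb{Z}^k,\ c_1\ge c_2\ge\cdots\ge c_k\ge 1\}$.
   Context: For a $k$-tuple $\mathbf{c}=(c_1,\ldots,c_k)$ of positive integers, $\eta_{\mathbf{c}}\colon\{0,\ldots,k-1\}^*\to\{0,\ldots,k-1\}^*$ is the morphism of free monoids given by $\eta_{\mathbf{c}}(j)=0^{c_{j+1}}(j+1)$ if $j<k-1$, and $\eta_{\mathbf{c}}(k-1)=0^{c_k}$. Limits of finite words are taken in the product topology. A Cantor real base is a bi-infinite sequence $B=(\beta_n)_{n\in\mathbb{Z}}$ of real numbers $\beta_n>1$ with $\prod_{n=1}^{+\infty}\beta_n=\prod_{n=1}^{+\infty}\beta_{-n}=+\infty$. For a bi-infinite sequence $\mathbf{a}=(a_n)_{n\in\mathbb{Z}}$ of non-negative integers with $a_n=0$ for all sufficiently large $n$, put $\mathrm{val}_B(\mathbf{a})=\sum_{n=0}^{+\infty}a_n\beta_{n-1}\cdots\beta_0+\sum_{n=1}^{+\infty}\frac{a_{-n}}{\beta_{-1}\cdots\beta_{-n}}$; if this is finite, $\mathbf{a}$ is a $B$-representation of $\mathrm{val}_B(\mathbf{a})$. The $B$-expansion of a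 non-negative real $x$ is its largest $B$-representation in the radix order, where $\mathbf{a}<_{\mathrm{rad}}\mathbf{b}$ if there is $i\in\mathbb{Z}$ with $a_j=b_j$ for all $j>i$ and $a_i<b_i$. (Equivalently it is produced by the greedy algorithm.) A non-negative real number $x$ is a $B$-integer if its $B$-expansion $(a_n)_{n\in\mathbb{Z}}$ satisfies $a_n=0$ for all $n<0$. The $B$-integers form a discrete set, listed increasingly as $0=x_0<x_1<x_2<\cdots$. An infinite word $w_0w_1w_2\cdots$ is the faithful coding of the $B$-integers if it encodes the distances between consecutive $B$-integers with precisely one letter per distance, i.e. for all $m,n\ge 0$, $w_m=w_n$ if and only if $x_{m+1}-x_m=x_{n+1}-x_n$ (it is unique up to renaming letters). *)

(* Defs.v *)
From mathcomp Require Import all_boot all_order all_algebra.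
From mathcomp Require Import all_classical all_reals all_analysis.
Set Implicit Arguments.
Unset Strict Implicit.
Unset Printing Implicit Defensive.
Import Order.TTheory GRing.Theory Num.Theory.
Import numFieldNormedType.Exports.
Local Open Scope classical_set_scope.
Local Open Scope ring_scope.

Section Substitutions.
Variable k : nat.

Definition letter0 (hk : (0 < k)%N) : 'I_k := Ordinal hk.

(* [tnth c j] is c_(j+1); [insub j.+1] is the letter j + 1, which exists
   exactly when j < k - 1. *)
Definition eta_letter (hk : (0 < k)%N) (c : k.-tuple nat) (j : 'I_k) :
    seq 'I_k :=
  nseq (tnth c j) (letter0 hk) ++
  (if insub j.+1 is Some j' then [:: j'] else [::]).

Definition eta (hk : (0 < k)%N) (c : k.-tuple nat) (w : seq 'I_k) : seq 'I_k :=
  flatten [seq eta_letter hk c j | j <- w].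

Definition substS (hk : (0 < k)%N) : set (seq 'I_k -> seq 'I_k) :=
  [set eta hk c | c in
     [set c : k.-tuple nat | sorted geq c /\ all (leq 1) c]].

(* psi_0 (psi_1 (... (psi_(n-1) u))) *)
Definition compose (psi : nat -> seq 'I_k -> seq 'I_k) (n : nat)
    (u : seq 'I_k) : seq 'I_k :=
  foldr psi u (iota 0 n).

End Substitutions.

Section WordLimit.
Variable A : choiceType.

(* Finite and infinite words over A both live in the product of copies of the
   discrete space [option A]; positions past the end of a finite word hold
   [None]. *)
Definition padded_word := {ptws nat -> discrete_topology (option A)}.

Definition of_finite (u : seq A) : padded_word := onth u.

Definition of_infinite (w : nat -> A) : padded_word := fun i => Some (w i).

Definition word_limit (u : nat -> seq A) (w : nat -> A) : Prop :=
  (of_finite (u n) @[n --> \oo]) --> of_infinite w.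

Lemma word_limitP (u : nat -> seq A) (w : nat -> A) :
  word_limit u w <-> forall i, \forall n \near \oo, onth (u n) i = Some (w i).
Proof.
rewrite /word_limit; split.
  move=> uw i.
  have pc : continuous (proj i : padded_word -> discrete_topology (option A)).
    exact: (@proj_continuous nat (fun=> discrete_topology (option A)) i).
  have /discrete_cvg H := cvg_comp _ _ uw (pc (of_infinite w)).
  exact: H.
move=> uw; apply/cvg_sup => i; apply/cvg_image => //.
  by apply/seteqP; split=> // x _; exists (fun=>x).
move=> U; rewrite nbhs_principalE => /principal_filterP Uw.
exists (proj i @^-1` U); last first.
  by apply: image_preimage; apply/seteqP; split=> // x _; exists (fun=> x).
apply: filterS (uw i) => n un_i.
by rewrite /= /proj /of_finite un_i.
Qed.

End WordLimit.

Section CantorRealBase.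
Variable R : realType.

Definition cantor_real_base (B : int -> R) : Prop :=
  [/\ forall n, 1 < B n,
      (\prod_(1 <= n < N.+1) B n%:Z) @[N --> \oo] --> +oo &
      (\prod_(1 <= n < N.+1) B (- n%:Z)) @[N --> \oo] --> +oo].

Definition valB (B : int -> R) (a : int -> nat) : \bar R :=
  (\sum_(0 <= n <oo) ((a n%:Z)%:R * \prod_(0 <= i < n) B i%:Z)%:E +
   \sum_(1 <= n <oo)
     ((a (- n%:Z))%:R / \prod_(1 <= i < n.+1) B (- i%:Z))%:E)%E.

Definition representation (B : int -> R) (x : R) (a : int -> nat) : Prop :=
  (exists N : int, forall n, N < n -> a n = 0%N) /\ valB B a = x%:E.

Definition lt_rad (a b : int -> nat) : Prop :=
  exists i : int, (forall j, i < j -> a j = b j) /\ (a i < b i)%N.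

Definition expansion (B : int -> R) (x : R) (a : int -> nat) : Prop :=
  representation B x a /\
  forall b, representation B x b -> b = a \/ lt_rad b a.

Definition Bintegers (B : int -> R) : set R :=
  [set x | 0 <= x /\
     exists a, expansion B x a /\ forall n : int, n < 0 -> a n = 0%N].

(* An increasing listing of a set in order type omega is unique, so the
   sequence x is determined by B. *)
Definition faithful_coding (T : Type) (B : int -> R) (w : nat -> T) : Prop :=
  exists x : nat -> R,
    [/\ x 0%N = 0,
        {homo x : m n / (m < n)%N >-> m < n},
        range x = Bintegers B &
        forall m n, w m = w n <-> x m.+1 - x m = x n.+1 - x n].

End CantorRealBase.

(* Main.v *)
Require Import Defs.
From mathcomp Require Import all_boot all_order all_algebra.
From mathcomp Require Import all_classical all_reals all_analysis.
From mathcomp Require Import zify ring lra.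
Set Implicit Arguments.
Unset Strict Implicit.
Unset Printing Implicit Defensive.
Import Order.TTheory GRing.Theory Num.Theory.
Import numFieldNormedType.Exports.

(* Write eta_(c^n) = psi_n and give the letter j a length l(j), with l(0) = 1,
   l strictly decreasing and positive.  The length gap n j of
   psi_0 ... psi_(n-1) (j) satisfies
     gap (n+1) j = c^n_(j+1) gap n 0 + gap n (j+1),
   where gap n k = 0; as c^n is non-increasing, gap n remains strictly
   decreasing in j.  Let B have the weights P n = gap n 0 at the positions
   n >= 0.  The recurrence says that a prefix of psi_0 ... psi_n (j) consists of
   q copies of psi_0 ... psi_(n-1) (0) followed by a prefix of the next block,
   and gap n (j+1) <= P n says that q is then the greedy digit of its length.
   So the lengths of the prefixes are the finite greedy sums of the weights P,
   which are the B-integers.  The negative part of B plays no role beyond the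
   fact that every real in [0, 1) has an expansion there. *)

(** * Greedy digit sums over a sequence of positive weights *)

Section GreedyDigits.
Local Open Scope ring_scope.
Variables (R : realType) (P : nat -> R).
Hypothesis P_gt0 : forall n, 0 < P n.

Definition digit_sum (a : nat -> nat) (n : nat) : R :=
  \sum_(i < n) (a i)%:R * P i.

(** Each tail of digits, together with the remainder [r], is worth less than the next weight. The
    case [m = 0] bounds [r] alone by [P 0]. *)
Definition greedy (a : nat -> nat) (r : R) (n : nat) : Prop :=
  forall m, (m <= n)%N -> digit_sum a m + r < P m.

Lemma digit_sum0 a : digit_sum a 0 = 0.
Proof. by rewrite /digit_sum big_ord0. Qed.

Lemma digit_sumS a n : digit_sum a n.+1 = digit_sum a n + (a n)%:R * P n.
Proof. by rewrite /digit_sum big_ord_recr. Qed.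

Lemma eq_digit_sum a b n :
  (forall i, (i < n)%N -> a i = b i) -> digit_sum a n = digit_sum b n.
Proof. by move=> ab; apply: eq_bigr => i _; rewrite ab. Qed.

Lemma digit_sum_widen a m n : (m <= n)%N ->
  (forall i, (m <= i)%N -> a i = 0%N) -> digit_sum a n = digit_sum a m.
Proof.
move=> mn a0; rewrite -(subnKC mn); elim: (n - m)%N => [|p IHp].
  by rewrite addn0.
by rewrite addnS digit_sumS IHp a0 ?leq_addr// mul0r addr0.
Qed.

Lemma digit_sum_ge0 a n : 0 <= digit_sum a n.
Proof. by apply: sumr_ge0 => i _; rewrite mulr_ge0 ?ler0n// ltW. Qed.

Definition set_digit (a : nat -> nat) (n q i : nat) : nat :=
  if i == n then q else a i.

Lemma set_digitE a n q : set_digit a n q n = q.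
Proof. by rewrite /set_digit eqxx. Qed.

Lemma digit_sum_set a n q m :
  (m <= n)%N -> digit_sum (set_digit a n q) m = digit_sum a m.
Proof.
move=> mn; apply: eq_digit_sum => i im.
by rewrite /set_digit ltn_eqF// (leq_trans im).
Qed.

Lemma greedy_set a r n q : greedy a r n ->
  digit_sum a n + q%:R * P n + r < P n.+1 -> greedy (set_digit a n q) r n.+1.
Proof.
move=> ga qP m; rewrite leq_eqVlt => /orP[/eqP->|]; last first.
  by rewrite ltnS => mn; rewrite digit_sum_set// ga.
by rewrite digit_sumS digit_sum_set// set_digitE.
Qed.

(** Division with remainder from the top: the digit at [n] is the integer part of [x / P n], and
    what is left is below [P n]. *)
Lemma greedy_exists n x : 0 <= x < P n ->
  exists a r, [/\ 0 <= r, x = digit_sum a n + r & greedy a r n].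
Proof.
elim: n x => [|n IHn] x /andP[x0 xP].
  exists (fun=> 0%N), x; rewrite digit_sum0 add0r; split=> // m.
  by rewrite leqn0 => /eqP->; rewrite digit_sum0 add0r.
have /andP[lb ub] := truncn_itv (divr_ge0 x0 (ltW (P_gt0 n))).
set q := Num.truncn _ in lb ub.
rewrite ler_pdivlMr// in lb; rewrite ltr_pdivrMr// in ub.
have [|a [r [r0 xE ga]]] := IHn (x - q%:R * P n).
  by move: ub; rewrite subr_ge0 lb -natr1 mulrDl mul1r /=; lra.
exists (set_digit a n q), r; split=> //.
  by rewrite digit_sumS digit_sum_set// set_digitE; lra.
by apply: greedy_set => //; lra.
Qed.

(** Greedy digits are the largest in the radix order. If [b] had a larger top digit, it would gain
    at least [P n], more than the whole tail of [a] with [r]; equal top digits cancel and the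
    comparison descends. *)
Lemma greedy_max a b r t n : 0 <= t -> greedy a r n ->
    digit_sum a n + r = digit_sum b n + t ->
  (forall m, (m < n)%N -> a m = b m) \/
  exists i, [/\ (i < n)%N, (b i < a i)%N &
                forall j, (i < j < n)%N -> a j = b j].
Proof.
move=> t0; elim: n => [|n IHn] ga; first by left.
rewrite !digit_sumS => abE.
have ga' : greedy a r n by move=> m mn; apply: ga; rewrite leqW.
case: (ltngtP (a n) (b n)) => [lt_ab|lt_ba|eq_ab].
- have := ga' n (leqnn n); have := digit_sum_ge0 b n.
  have : (a n).+1%:R * P n <= (b n)%:R * P n by rewrite ler_pM2r// ler_nat.
  by rewrite -natr1 mulrDl mul1r; lra.
- by right; exists n; split=> // j; lia.
- have [|eqab|[i [lt_in ba eqab]]] := IHn ga'.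
    by rewrite eq_ab in abE; lra.
  + by left=> m; rewrite ltnS leq_eqVlt => /orP[/eqP->//|]; exact: eqab.
  + right; exists i; split=> // [|j /andP[ij]]; first exact: leqW.
    rewrite ltnS leq_eqVlt => /orP[/eqP->//|jn].
    by apply: eqab; rewrite ij.
Qed.

End GreedyDigits.

(** * Lengths of the prefixes of a word with weighted letters *)

Section PrefixSums.
Local Open Scope ring_scope.
Variables (R : realType) (A : Type) (l : A -> R).

Definition wlength (u : seq A) : R := \sum_(i <- u) l i.

(** Only proper prefixes count, so in a concatenation the point between two blocks belongs to the
    second block alone. *)
Definition prefix_sum (u : seq A) (x : R) : Prop :=
  exists2 i, (i < size u)%N & x = wlength (take i u).

Lemma wlength_cat u v : wlength (u ++ v) = wlength u + wlength v.
Proof. by rewrite /wlength big_cat. Qed.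

Lemma wlength_flatten_nseq q u :
  wlength (flatten (nseq q u)) = q%:R * wlength u.
Proof.
elim: q => [|q IHq] /=; first by rewrite /wlength big_nil mul0r.
by rewrite wlength_cat IHq -natr1; ring.
Qed.

Lemma prefix_sum_cat u v x : prefix_sum (u ++ v) x <->
  prefix_sum u x \/ prefix_sum v (x - wlength u).
Proof.
split=> [[i]|[[i iu ->]|[i iv xE]]].
- rewrite size_cat take_cat; case: (ltnP i (size u)) => [iu _ ->|ui iuv ->].
    by left; exists i.
  right; exists (i - size u)%N; first by rewrite ltn_subLR.
  by rewrite wlength_cat addrC addKr.
- exists i; first by rewrite size_cat ltn_addr.
  by rewrite take_cat iu.
- exists (size u + i)%N; first by rewrite size_cat ltn_add2l.
  by rewrite takeD take_size_cat// drop_size_cat// wlength_cat -xE; ring.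
Qed.

Lemma prefix_sum_flatten_nseq q u x : prefix_sum (flatten (nseq q u)) x <->
  exists2 p, (p < q)%N & prefix_sum u (x - p%:R * wlength u).
Proof.
elim: q x => [|q IHq] x /=; first by split=> [[]|[]].
rewrite prefix_sum_cat IHq; split=> [[ux|[p pq ux]]|[[|p] pq ux]].
- by exists 0%N => //; rewrite mul0r subr0.
- by exists p.+1 => //; rewrite -natr1 mulrDl mul1r [_ + wlength u]addrC
    opprD addrA.
- by left; rewrite mul0r subr0 in ux.
- right; exists p => //.
  by move: ux; rewrite -natr1 mulrDl mul1r [_ + wlength u]addrC opprD addrA.
Qed.

End PrefixSums.

(** * A Cantor real base with prescribed weights, and its integers *)

Section PositionalBase.
Local Open Scope classical_set_scope.
Local Open Scope ring_scope.
Variables (R : realType) (P : nat -> R).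
Hypothesis P0 : P 0 = 1.
Hypothesis P_incr : forall n, P n < P n.+1.
Hypothesis P_cvgy : P n @[n --> \oo] --> +oo.

Let P_homo : {homo P : m n / (m <= n)%N >-> m <= n}.
Proof. by apply: homo_leq => // [y x z|n]; [exact: le_trans|exact: ltW]. Qed.

Let P_gt0 n : 0 < P n.
Proof. by rewrite (lt_le_trans _ (P_homo (leq0n n)))// P0. Qed.

(* [P n] is the weight of the digit at position [n >= 0].  The value 2 on the
   negative side is arbitrary. *)
Definition base (z : int) : R := if z is Posz n then P n.+1 / P n else 2.

Lemma prod_base n : \prod_(0 <= i < n) base i%:Z = P n.
Proof.
elim: n => [|n IHn]; first by rewrite big_geq.
by rewrite big_nat_recr//= IHn mulrC divfK// gt_eqF.
Qed.

Lemma prod_baseN n : \prod_(1 <= i < n.+1) base (- i%:Z) = 2 ^+ n.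
Proof.
elim: n => [|n IHn]; first by rewrite big_geq.
by rewrite big_nat_recr//= IHn exprSr.
Qed.

Lemma valB_base (a : int -> nat) n :
    (forall m, (n <= m)%N -> a m%:Z = 0%N) ->
  valB base a = ((digit_sum P (fun i => a i%:Z) n)%:E +
    \sum_(1 <= i <oo) ((a (- i%:Z))%:R / 2 ^+ i)%:E)%E.
Proof.
move=> a0; congr (_ + _)%E; last first.
  apply/congr_lim/eq_fun => m /=; apply: eq_bigr => i _.
  by rewrite prod_baseN.
rewrite (@nneseries_split _ _ 0 n) => [|i _]; last first.
  by rewrite lee_fin prod_base mulr_ge0 ?ler0n// ltW.
rewrite add0n eseries0 => [|i ni _]; last by rewrite a0// mul0r.
rewrite adde0 sumEFin big_mkord; congr EFin; apply: eq_bigr => i _.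
by rewrite prod_base.
Qed.

(** Here [t] is the fractional part. Its series has non-negative terms, each at most [t], so [t = 0]
    kills every digit at a negative position. *)
Lemma representation_base x (a : int -> nat) : representation base x a ->
  exists n t, [/\ 0 <= t, (forall m, (n <= m)%N -> a m%:Z = 0%N),
    x = digit_sum P (fun i => a i%:Z) n + t &
    t = 0 -> forall z : int, z < 0 -> a z = 0%N].
Proof.
move=> [[N aN] ax].
exists `|N|%N.+1.
have a0 m : (`|N|%N.+1 <= m)%N -> a m%:Z = 0%N.
  by move=> Nm; apply: aN; lia.
move: ax; rewrite (valB_base a0).
set u : nat -> \bar R := fun i => ((a (- i%:Z))%:R / 2 ^+ i)%:E.
have u0 i : (0 <= u i)%E by rewrite lee_fin divr_ge0 ?ler0n ?exprn_ge0.
set t := (\sum_(1 <= i <oo) u i)%E.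
have t0 : (0 <= t)%E by exact: nneseries_ge0.
have ut i : (0 < i)%N -> (u i <= t)%E.
  move=> i0; apply: le_trans (nneseries_lim_ge i.+1 (fun n _ _ => u0 n)).
  by rewrite big_nat_recr//= lee_paddl// sume_ge0.
case: t t0 ut => [t||]//= t0 ut [<-]; exists t; split=> //.
move=> tE [//|z] _.
have := ut z.+1 isT; rewrite tE lee_fin pmulr_lle0 ?invr_gt0 ?exprn_gt0//.
by rewrite lern0 => /eqP.
Qed.

(** With [q i] the integer part of [2 ^+ i * r], the digits [q i - 2 * q (i - 1)] have partial sums
    telescoping to [q n / 2 ^+ n], which lies within [2 ^- n] of [r]; [r < 1] gives [q 0 = 0]. *)
Lemma binary_expansion (r : R) : 0 <= r < 1 -> exists d : nat -> nat,
  (\sum_(1 <= i <oo) ((d i)%:R / 2 ^+ i)%:E)%E = r%:E.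
Proof.
move=> /andP[r0 r1].
pose q i := Num.truncn (2 ^+ i * r).
have q_itv i : (q i)%:R <= 2 ^+ i * r < (q i).+1%:R.
  by apply: truncn_itv; rewrite mulr_ge0// exprn_ge0.
have q0 : q 0 = 0%N.
  by apply: truncn_def; rewrite expr0 mul1r r0.
have qS i : ((q i).*2 <= q i.+1)%N.
  rewrite -ltnS -(ltr_nat R).
  have /andP[+ _] := q_itv i; have /andP[_] := q_itv i.+1.
  by rewrite exprS -muln2 natrM; lra.
exists (fun i => q i - (q i.-1).*2)%N.
have sumE n : \sum_(1 <= i < n.+1) (q i - (q i.-1).*2)%:R / 2 ^+ i =
              (q n)%:R / 2 ^+ n :> R.
  elim: n => [|n IHn]; first by rewrite big_geq// q0 mul0r.
  rewrite big_nat_recr//= IHn natrB// -muln2 natrM exprS.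
  by field; rewrite expf_neq0.
apply: cvg_lim => //.
rewrite -(cvg_shiftn 1) /=.
rewrite (_ : (fun n => _) = (fun n => ((q n)%:R / 2 ^+ n)%:E)); last first.
  by apply/funext => n; rewrite addn1 sumEFin sumE.
apply: cvg_EFin; first exact: nearW.
apply: (@squeeze_cvgr _ _ _ _ (fun n => r - 2^-1 ^+ n) (fun=> r)).
- apply: nearW => n; have /andP[lb ub] := q_itv n.
  have p0 : 0 < 2 ^+ n :> R by rewrite exprn_gt0.
  rewrite ler_pdivrMr// ler_pdivlMr// mulrBl -exprMn mulVf// expr1n.
  by rewrite [r * _]mulrC lb -natr1 in ub *; rewrite andbT; lra.
- rewrite -[X in _ --> X]subr0; apply: cvgB; first exact: cvg_cst.
  by apply: cvg_expr; rewrite gtr0_norm; lra.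
- exact: cvg_cst.
Qed.

Lemma base_integerP x : Bintegers base x <->
  exists n a, greedy P a 0 n /\ x = digit_sum P a n.
Proof.
split=> [[x0 [e [[e_rep e_max] e_neg]]]|[n [a [ga xE]]]].
- have [N [_ [_ eN _ _]]] := representation_base e_rep.
  (* [M] lies above all non-zero digits of [e], and [x < P M] lets the greedy algorithm start at
     [M]. *)
  have [M [NM xM]] : exists M, (N <= M)%N /\ x < P M.
    have /cvgryPgt/(_ x) xP := P_cvgy.
    near \oo => M; exists M; split; near: M => //.
    exact: nbhs_infty_ge.
  have eM m : (M <= m)%N -> e m%:Z = 0%N.
    by move=> Mm; rewrite eN// (leq_trans NM).
  have xeM : x = digit_sum P (fun i => e i%:Z) M.
    case: e_rep => _; rewrite (valB_base eM) eseries0 => [|i i1 _].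
      by rewrite adde0 => -[].
    by rewrite e_neg ?mul0r//; lia.
  have [|a [r [r0 xE ga]]] := @greedy_exists _ _ P_gt0 M x; first by rewrite x0.
  suff [ae|[i [iM ei ae]]] : (forall m, (m < M)%N -> a m = e m%:Z) \/
      exists i, [/\ (i < M)%N, (e i%:Z < a i)%N &
                 forall j, (i < j < M)%N -> a j = e j%:Z].
  + have xaM : x = digit_sum P a M by rewrite xeM; apply/esym/eq_digit_sum.
    by exists M, a; split=> // m /ga; have -> : r = 0 by lra.
  (* If [a] beats [e], completing [a] by binary digits of [r] at the negative positions gives a
     representation [g] of [x] that is radix-larger than the expansion [e]. *)
  + have /binary_expansion[d dE] : 0 <= r < 1.
      by rewrite r0 -P0; have := ga 0%N isT; rewrite digit_sum0 add0r.
    pose g (z : int) :=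
      match z with
      | Posz m => if (m < M)%N then a m else 0%N
      | Negz m => d m.+1
      end.
    have gM m : (M <= m)%N -> g m%:Z = 0%N by rewrite /= ltnNge => ->.
    have g_rep : representation base x g.
      split; first by exists M%:Z => -[m /=|//]; rewrite ltz_nat => /ltnW/gM.
      rewrite (valB_base gM) xE EFinD; congr (_ + _)%E.
        by congr EFin; apply: eq_digit_sum => i' i'M; rewrite /= i'M.
      rewrite -dE; apply/congr_lim/eq_fun => m /=; apply: eq_big_nat => -[|j]//.
    have [ge|[z [eqge lt_ge]]] := e_max _ g_rep.
      by move: ei; rewrite -ge /= iM ltnn.
    have gi : (e i%:Z < g i%:Z)%N by rewrite /= iM.
    have [zi|iz|zi] := ltgtP z i%:Z.
    * by move: gi; rewrite eqge// ltnn.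
    * case: z iz eqge lt_ge => // z; rewrite ltz_nat => iz eqge /=.
      by case: (ltnP z M) => [zM|/eM->//]; rewrite -ae ?ltnn// iz.
    * by move: lt_ge; rewrite zi ltnNge ltnW.
  + by apply: (greedy_max P_gt0 (lexx 0) ga); rewrite addr0 -xE.
- pose A (z : int) :=
    if z is Posz m then if (m < n)%N then a m else 0%N else 0%N.
  have A0 m : (n <= m)%N -> A m%:Z = 0%N by rewrite /= ltnNge => ->.
  have AE m : (m <= n)%N -> digit_sum P (fun i => A i%:Z) m = digit_sum P a m.
    by move=> mn; apply: eq_digit_sum => i im; rewrite /= (leq_trans im).
  have xA : x = digit_sum P (fun i => A i%:Z) n by rewrite AE.
  (* Above [n] the digit sum stays constant while the weights grow. *)
  have gA m : greedy P (fun i => A i%:Z) 0 m.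
    move=> i _; have [i_n|/ltnW ni] := leqP i n.
      by rewrite AE//; apply: ga.
    rewrite (digit_sum_widen _ ni A0) AE//.
    by apply: lt_le_trans (P_homo ni); exact: ga.
  split; first by rewrite xE digit_sum_ge0.
  exists A; split=> [|z]; last by case: z.
  split.
    split; first by exists n%:Z => -[m /=|//]; rewrite ltz_nat => /ltnW/A0.
    rewrite (valB_base A0) -xA eseries0 ?adde0// => -[//|i] _ _.
    by rewrite /= mul0r.
  move=> b /representation_base[N [t [t0 b0 xb t_eq0]]].
  have [nM NM] : (n <= maxn n N)%N /\ (N <= maxn n N)%N.
    by rewrite leq_maxl leq_maxr.
  have := greedy_max P_gt0 t0 (gA (maxn n N)).
  rewrite (digit_sum_widen _ nM A0) -xA addr0.
  move=> /(_ (fun i => b i%:Z)); rewrite (digit_sum_widen _ NM b0) -xb.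
  move=> /(_ erefl)[Ab|[i [iM bA Ab]]].
  (* Equal digits at all non-negative positions leave [t = 0], hence no negative part in [b]. *)
  + left; apply/funext => -[m|m].
      have [/Ab//|Mm] := ltnP m (maxn n N).
      by rewrite A0 ?b0// (leq_trans _ Mm).
    rewrite t_eq0//; move: xb.
    rewrite -(digit_sum_widen _ NM b0) -(eq_digit_sum _ Ab).
    by rewrite (digit_sum_widen _ nM A0) -xA; lra.
  + right; exists i%:Z; split=> // -[j|//]; rewrite ltz_nat => ij.
    have [jM|Mj] := ltnP j (maxn n N); first by rewrite Ab// ij.
    by rewrite A0 ?b0// (leq_trans _ Mj).
Unshelve. all: by end_near. Qed.

Lemma cantor_real_base_base : cantor_real_base base.
Proof.
split=> [[n|n]||].
- by rewrite /= ltr_pdivlMr// mul1r.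
- by rewrite /=; lra.
(* The product starts at index 1, so it telescopes down to [P 1] and not to [P 0]. *)
- rewrite (_ : (fun n => _) = (fun n => P n.+1 / P 1)); last first.
    apply/funext; elim=> [|n IHn]; first by rewrite big_geq// divff// gt_eqF.
    by rewrite big_nat_recr//= IHn mulrC mulrA divfK// gt_eqF.
  have P1 : 0 < (P 1)^-1 by rewrite invr_gt0.
  have PS : P n.+1 @[n --> \oo] --> +oo by rewrite (cvg_shiftS P).
  exact: (gt0_cvgMly (F := P n.+1 @[n --> \oo]) (f := id) P1 PS).
- rewrite (_ : (fun n => _) = (fun n => 2 ^+ n)); last first.
    by apply/funext => n; exact: prod_baseN.
  apply: ger_cvgy cvgr_idn; apply: nearW => n.
  by rewrite -natrX ler_nat ltnW// ltn_expl.
Qed.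

End PositionalBase.

(** * Block lengths, and then the words themselves *)

Section Words.
Local Open Scope ring_scope.
Variables (R : realType) (k : nat) (hk : (2 <= k)%N).
Variable psi : nat -> seq 'I_k -> seq 'I_k.
Variable c : nat -> k.-tuple nat.
Hypothesis c_geq : forall n, sorted geq (c n).
Hypothesis c_gt0 : forall n, all (leq 1) (c n).
Hypothesis psiE : forall n, psi n = eta (ltnW hk) (c n).

(** The default 0 keeps the digits non-increasing past the end of the tuple and makes [gap n j]
    vanish for [j >= k]. *)
Let digit n j := nth 0%N (c n) j.

Let digit_le n j : (digit n j.+1 <= digit n j)%N.
Proof.
rewrite /digit; have [jk|kj] := ltnP j.+1 k; last first.
  by rewrite nth_default// size_tuple.
have geq_trans : transitive geq by move=> a b d /= ba /leq_trans; apply.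
by apply: (sorted_ltn_nth geq_trans 0%N (c_geq n));
  rewrite ?inE ?size_tuple// ltnW.
Qed.

Let digit_gt0 n j : (j < k)%N -> (0 < digit n j)%N.
Proof.
move=> jk; have /all_nthP := c_gt0 n; apply; by rewrite size_tuple.
Qed.

(* [gap n j] is the length of [psi_0 ... psi_(n-1) (j)] when the letter [j] has
   length [gap 0 j]; the only constraints on the latter are [gap 0 0 = 1] and
   strict decrease to [gap 0 k = 0]. *)
Fixpoint gap (n j : nat) : R :=
  if n is m.+1 then (digit m j)%:R * gap m 0 + gap m j.+1
  else (k - j)%:R / k%:R.

Lemma gap_ge0 n j : 0 <= gap n j.
Proof.
elim: n j => [|n IHn] j /=; first by rewrite divr_ge0 ?ler0n.
by rewrite addr_ge0// mulr_ge0 ?ler0n.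
Qed.

Lemma gap_ge n j : (k <= j)%N -> gap n j = 0.
Proof.
elim: n j => [|n IHn] j kj /=.
  by move: kj; rewrite -subn_eq0 => /eqP->; rewrite mul0r.
by rewrite (IHn j.+1) ?leqW// /digit nth_default ?size_tuple// mul0r addr0.
Qed.

(** The digits do not increase with [j], and the second summand decreases strictly by induction. At
    the last letter strictness comes from [c_k >= 1] instead. *)
Lemma gap_decr n j : (j < k)%N -> gap n j.+1 < gap n j.
Proof.
have k0 : (0 < k)%N by exact: ltnW.
elim: n j => [|n IHn] j jk /=.
  by rewrite ltr_pM2r ?invr_gt0 ?ltr0n// ltr_nat; lia.
have gap0 : 0 < gap n 0.
  by apply: le_lt_trans (gap_ge0 n 1) _; apply: IHn.
have [jk'|kj] := ltnP j.+1 k.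
  by rewrite ler_ltD ?IHn// ler_wpM2r ?gap_ge0// ler_nat.
rewrite (gap_ge _ kj) (gap_ge n (leqW kj)) addr0.
rewrite /digit nth_default ?size_tuple// mul0r ltr_wpDr ?gap_ge0//.
by rewrite mulr_gt0 ?ltr0n ?digit_gt0.
Qed.

Lemma gap_le n i j : (i <= j)%N -> gap n j <= gap n i.
Proof.
apply: (homo_leq (r := fun x y => y <= x)) => // [y x z yx /le_trans|{}j].
  exact.
have [jk|kj] := ltnP j k; first by rewrite ltW// gap_decr.
by rewrite !gap_ge// leqW.
Qed.

Lemma gap_gt0 n j : (j < k)%N -> 0 < gap n j.
Proof. by move=> jk; apply: le_lt_trans (gap_ge0 n j.+1) (gap_decr n jk). Qed.

Lemma gap00 : gap 0 0 = 1.
Proof. by rewrite /= subn0 divff// pnatr_eq0; lia. Qed.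

Lemma gap_incr n : gap n 0 + gap n 1 <= gap n.+1 0.
Proof.
rewrite /= lerD2r ler_peMl ?gap_ge0// ler1n digit_gt0//.
exact: ltnW.
Qed.

Lemma gap0_incr n : gap n 0 < gap n.+1 0.
Proof. by apply: lt_le_trans (gap_incr n); rewrite ltrDl gap_gt0. Qed.

(** From index 1 on, each step adds at least 1: [gap n.+2 0] exceeds [gap n.+1 0] by at least
    [gap n.+1 1], which is at least [gap n 0] because the letter 1 exists and its digit is
    positive. *)
Lemma gap0_ge n : n%:R <= gap n 0.
Proof.
have gap0_ge1 m : 1 <= gap m 0.
  by rewrite -gap00; apply: (@homo_leq _ (gap^~ 0) <=%R) => // [x y z|i];
    [exact: le_trans|exact/ltW/gap0_incr].
case: n => [|n]; first exact: gap_ge0.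
elim: n => [|n IHn]; first exact: gap0_ge1.
rewrite -natr1; apply: le_trans (gap_incr n.+1); apply: lerD => //.
apply: le_trans (gap0_ge1 n) _.
rewrite /= -[leLHS]addr0; apply: lerD; last exact: gap_ge0.
by rewrite ler_peMl ?gap_ge0// ler1n digit_gt0.
Qed.

Lemma gap0_cvgy : (gap n 0 @[n --> \oo] --> +oo)%classic.
Proof. by apply: ger_cvgy cvgr_idn; apply: nearW => n; exact: gap0_ge. Qed.

(** * The iterated images of letters and the lengths of their prefixes *)

Let zero := letter0 (ltnW hk).

Let W n (j : 'I_k) := compose psi n [:: j].

Let l (j : 'I_k) := gap 0 j.

Lemma compose_cat n u v :
  compose psi n (u ++ v) = compose psi n u ++ compose psi n v.
Proof.
rewrite /compose; elim: (iota 0 n) => //= m s ->.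
by rewrite psiE /eta map_cat flatten_cat.
Qed.

Lemma compose_nil n : compose psi n [::] = [::].
Proof.
by rewrite /compose; elim: (iota 0 n) => //= m s ->; rewrite psiE.
Qed.

Lemma composeS n u : compose psi n.+1 u = compose psi n (psi n u).
Proof. by rewrite /compose -addn1 iotaD foldr_cat. Qed.

Lemma compose_letterS n j : W n.+1 j =
  flatten (nseq (digit n j) (W n zero)) ++
  (if insub j.+1 is Some j' then W n j' else [::]).
Proof.
rewrite /W composeS psiE /eta /= cats0 /eta_letter compose_cat.
congr (_ ++ _); last by case: insubP => // _; rewrite compose_nil.
rewrite (tnth_nth 0%N) -/(digit n j).
elim: (digit n j) => [|m IHm] /=; first exact: compose_nil.
by rewrite -cat1s compose_cat IHm.
Qed.

Lemma wlength_compose n j : wlength l (W n j) = gap n j.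
Proof.
elim: n j => [|n IHn] j; first by rewrite /wlength big_seq1.
rewrite compose_letterS wlength_cat wlength_flatten_nseq IHn /=.
congr (_ + _); case: insubP => [j' _ <-//|].
by rewrite -leqNgt => kj; rewrite gap_ge// /wlength big_nil.
Qed.

(** Induction on [n] for all letters at once, along the blocks of [compose_letterS]. The number of
    full copies of [W n zero] before the cut becomes the digit at position [n]. *)
Lemma prefix_sum_composeP n j x : prefix_sum l (W n j) x <->
  x < gap n j /\
  exists a, greedy (gap^~ 0) a 0 n /\ x = digit_sum (gap^~ 0) a n.
Proof.
elim: n j x => [|n IHn] j x.
  rewrite /W /=; split=> [[[|//] _ ->]|[_ [a [_ ->]]]].
    rewrite /wlength big_nil; split; first exact: (gap_gt0 0 (ltn_ord j)).
    exists (fun=> 0%N); rewrite digit_sum0; split=> // m.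
    rewrite leqn0 => /eqP->; rewrite digit_sum0 addr0.
    by apply: gap_gt0; exact: ltnW.
  by exists 0%N => //; rewrite digit_sum0 /wlength big_nil.
have P0 m : 0 < gap m 0 by rewrite gap_gt0// ltnW.
have gapD q : (q < digit n j)%N ->
    q%:R * gap n 0 + gap n 0 <= (digit n j)%:R * gap n 0.
  move=> qc; rewrite -[X in _ + X]mul1r -mulrDl natr1.
  by rewrite ler_wpM2r ?gap_ge0// ler_nat.
have step q : x < gap n.+1 j ->
    (exists a, greedy (gap^~ 0) a 0 n /\
       x - q%:R * gap n 0 = digit_sum (gap^~ 0) a n) ->
  x < gap n.+1 j /\
    exists a, greedy (gap^~ 0) a 0 n.+1 /\ x = digit_sum (gap^~ 0) a n.+1.
  (* The new greedy condition at [n.+1] holds because [x < gap n.+1 j <= gap n.+1 0]. *)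
  move=> lt_x [a [ga yE]]; split=> //; exists (set_digit a n q); split.
    apply: greedy_set => //; rewrite addr0 -yE subrK.
    by apply: lt_le_trans lt_x _; exact: gap_le.
  by rewrite digit_sumS set_digitE digit_sum_set// -yE subrK.
rewrite compose_letterS prefix_sum_cat prefix_sum_flatten_nseq.
rewrite wlength_flatten_nseq !wlength_compose; split.
- case=> [[q qc /IHn[xq ex]]|].
    apply: step ex; rewrite /=; have := gapD _ qc; have := gap_ge0 n j.+1.
    by move: xq; rewrite /=; lra.
  case: insubP => [j' _ j'E /IHn[xj' ex]|_ []//].
  by apply: step ex; rewrite -ltrBlDl -j'E.
- case=> lt_x [a [ga xE]].
  have ga' : greedy (gap^~ 0) a 0 n by move=> m mn; apply: ga; rewrite leqW.
  (* A digit above [digit n j] would push [x] past the end of the word, since the last block has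
     length [gap n j.+1 <= gap n 0]. *)
  rewrite digit_sumS in xE.
  have an : (a n <= digit n j)%N.
    rewrite leqNgt; apply/negP => lt_a.
    have : (digit n j).+1%:R * gap n 0 <= (a n)%:R * gap n 0.
      by rewrite ler_wpM2r ?gap_ge0// ler_nat.
    have := digit_sum_ge0 P0 a n; have := gap_le n (leq0n j.+1).
    by move: lt_x; rewrite -natr1 mulrDl mul1r /=; lra.
  have yE : x - (a n)%:R * gap n 0 = digit_sum (gap^~ 0) a n.
    by rewrite xE addrK.
  (* With the maximal digit the cut falls in the block of the letter [j + 1]; if there is none, the
     rest would be negative. With a smaller digit it falls in a copy of [W n zero]. *)
  move: an; rewrite leq_eqVlt => /orP[/eqP anE|an].
    right; rewrite -anE yE.
    have lt_y : digit_sum (gap^~ 0) a n < gap n j.+1.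
      by rewrite -yE anE ltrBlDl.
    case: insubP => [j' _ j'E|].
      by apply/IHn; rewrite j'E; split=> //; exists a.
    rewrite -leqNgt => /(gap_ge n) gap_eq0.
    by have := digit_sum_ge0 P0 a n; rewrite leNgt -gap_eq0 lt_y.
  left; exists (a n) => //; apply/IHn; rewrite yE; split; last by exists a.
  by have := ga' n (leqnn n); rewrite addr0.
Qed.

(** * The limit word and its coding of the integers of the base *)

Let u n := W n zero.

Lemma size_compose_gt0 n j : (0 < size (W n j))%N.
Proof.
have := gap_gt0 n (ltn_ord j); rewrite -wlength_compose.
by case: (W n j) => //; rewrite /wlength big_nil ltxx.
Qed.

(** The image of 0 starts with 0 because [c_1 >= 1], and it continues at least with the letter 1,
    whose block is non-empty. *)
Lemma compose_prefixS n : exists2 s, (0 < size s)%N & u n.+1 = u n ++ s.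
Proof.
rewrite /u compose_letterS; have := digit_gt0 n (ltn_ord zero).
case: (digit n zero) => // q _ /=; rewrite -catA; eexists; last by [].
rewrite size_cat addn_gt0; apply/orP; right.
by case: insubP => [j' _ _|]; [exact: size_compose_gt0|rewrite /= hk].
Qed.

Lemma compose_prefix m n : (m <= n)%N -> exists s, u n = u m ++ s.
Proof.
move=> /subnKC<-; elim: (n - m)%N => [|p [s IHp]].
  by exists [::]; rewrite addn0 cats0.
have [t _ uE] := compose_prefixS (m + p).
by exists (s ++ t); rewrite addnS uE IHp catA.
Qed.

Lemma size_compose n : (n < size (u n))%N.
Proof.
elim: n => [|n IHn]; first exact: size_compose_gt0.
by have [s s0 ->] := compose_prefixS n; rewrite size_cat; lia.
Qed.

(** A diagonal choice: [u i] has more than [i] letters, so the default is never read, and the [u n]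
    are prefixes of one another. *)
Let w i := nth zero (u i) i.

Lemma nth_compose n i : (i < size (u n))%N -> nth zero (u n) i = w i.
Proof.
move=> iun; rewrite /w; have [n_i|/ltnW i_n] := leqP n i.
  by have [s ->] := compose_prefix n_i; rewrite nth_cat iun.
by have [s ->] := compose_prefix i_n; rewrite nth_cat size_compose.
Qed.

Lemma take_compose n i : (i <= size (u n))%N -> take i (u n) = mkseq w i.
Proof.
move=> iun.
apply: (@eq_from_nth _ zero); rewrite size_takel ?size_mkseq// => m mi.
by rewrite nth_take// nth_mkseq// nth_compose// (leq_trans mi).
Qed.

Lemma word_limit_compose : word_limit u w.
Proof.
apply/word_limitP => i; exists i => // n /= i_n.
have iun : (i < size (u n))%N by exact: leq_ltn_trans (size_compose n).
by rewrite onthE (nth_map zero)// nth_compose.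
Qed.

Lemma faithful_coding_compose : faithful_coding (base (gap^~ 0)) w.
Proof.
have base_intP := @base_integerP R (gap^~ 0) gap00 gap0_incr gap0_cvgy.
pose x i := wlength l (mkseq w i).
have xS i : x i.+1 - x i = l (w i).
  by rewrite /x mkseqS -cats1 wlength_cat addrC addKr /wlength big_seq1.
exists x; split.
- by rewrite /x /wlength big_nil.
- apply: homo_ltn => [y z t|i]; first exact: lt_trans.
  by rewrite -subr_gt0 xS gap_gt0.
- apply/seteqP; split=> [_ [i _ <-]|y]; rewrite /= base_intP.
  + have : prefix_sum l (u i) (x i).
      exists i; first exact: size_compose.
      by rewrite take_compose// ltnW// size_compose.
    by move=> /prefix_sum_composeP[_ [a ax]]; exists i, a.
  + move=> [n [a [ga yE]]].
    have /prefix_sum_composeP[i iun ->] : y < gap n zero /\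
        exists a, greedy (gap^~ 0) a 0 n /\ y = digit_sum (gap^~ 0) a n.
      split; last by exists a.
      by rewrite yE; have := ga n (leqnn n); rewrite addr0.
    by exists i => //; rewrite take_compose// ltnW.
- move=> m n; rewrite !xS; split=> [->//|]; rewrite /l.
  (* Strict decrease of the letter lengths makes [l] injective, so each distance has one letter. *)
  have gap_neq (i j : 'I_k) : (i < j)%N -> gap 0 j < gap 0 i.
    by move=> ij; apply: le_lt_trans (gap_le 0 ij) (gap_decr 0 (ltn_ord i)).
  have [/gap_neq/lt_eqF/eqP|/gap_neq/gt_eqF/eqP|/val_inj//] :=
    ltngtP (w m) (w n).
    by move=> + /esym.
  by move=> + /esym.
Qed.

End Words.

Theorem theorem25 (R : realType) (k : nat) (hk : (2 <= k)%N)
    (psi : nat -> seq 'I_k -> seq 'I_k)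
    (hpsi : forall n, substS (ltnW hk) (psi n)) :
  exists w : nat -> 'I_k,
    word_limit (fun n => compose psi n [:: letter0 (ltnW hk)]) w /\
    exists B : int -> R, cantor_real_base B /\ faithful_coding B w.
Proof.
have /choice[c cE] : forall n, exists c : k.-tuple nat,
    [/\ sorted geq c, all (leq 1) c & psi n = eta (ltnW hk) c].
  by move=> n; have [c [c_geq c_gt0] <-] := hpsi n; exists c.
have c_geq n : sorted geq (c n) by have [] := cE n.
have c_gt0 n : all (leq 1) (c n) by have [] := cE n.
have psiE n : psi n = eta (ltnW hk) (c n) by have [] := cE n.
eexists; split; first exact: (word_limit_compose R c_geq c_gt0 psiE).
exists (base (fun n => gap R c n 0)); split.
  apply: cantor_real_base_base.
  - exact: gap00.
  - exact: gap0_incr.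
  - exact: gap0_cvgy.
exact: (faithful_coding_compose R c_geq c_gt0 psiE).
Qed.
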